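(* Let $M$ be a mean-field game (MFG) model on a finite undirected network $\Gamma$ and $W$ the corresponding Wardrop model on the directed network $\bar\Gamma$. Suppose that for every edge $e_k=(v_r,v_i)$ of $\Gamma$ the travel costs are reversible ($c_k^i(j)=c_k^r(j)$ for all $j\in\mathbb R$), even ($c_k^i(-j)=c_k^i(j)$ for all $j\in\mathbb R$), increasing for positive current, and such that the sum of the costs of the two directed edges $\bar e_k^i$ and $\bar e_k^r$ is positive at every current. Then in the Wardrop model $W$ the current is unique in the edges corresponding to $e_k$; that is, any two Wardrop equilibria of $W$ have the same currents on $\bar e_k^i$ and on $\bar e_k^r$, for every edge $e_k$ of $\Gamma$.
   Context: **Network and costs.** $\Gamma=(E,V)$ is a finite undirected network; an edge $e_k$ with endpoints $v_r,v_i$ is written $e_k=(v_r,v_i)$. Some vertices are entrance vertices and some others (disjoint from these) are exit vertices; all of them have incidence $1$. A current $\iota>0$ is prescribed at each entrance vertex; exit costs are zero. On each edge $e_k=(v_r,v_i)$ the MFG has two travel costs depending on the signed current $j\in\mathbb R$ in the edge: $c_k^i(j)$ for moving from $v_r$ to $v_i$ and $c_k^r(j)$ for moving from $v_i$ to $v_r$. (They are $c_k^i(j)=\min\int_0^TL_k(x,\dot x,m^k(x,j))dt$ over $T$ and Lipschitz trajectories from $0$ to $1$, respectively from $1$ to $0$ for $c_k^r$, where the edge is identified with $[0,1]$, $L_k$ is the Lagrangian $L_k(x,v,m)=\sup_p\{-pv-H_k(x,p,m)\}$ of the Hamiltonian $H_k$ of the edge, smooth and convex in $p$, and $m^k(x,j)$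 is the density determined by $H_k(x,u_x,m)=0$, $-mD_pH_k(x,u_x,m)=j$.) Moving from $e_k$ to $e_l$ through a common vertex $v_i$ costs a constant $\psi_{kl}^i$, with $\psi^i_{kl}\le\psi^i_{kp}+\psi^i_{pl}$ at vertices with more than two incident edges. **Corresponding Wardrop model $W$.** The vertices of $\bar\Gamma$ are the pairs $(e_k,v_i)$ with $v_i$ an endpoint of $e_k$. For each edge $e_k=(v_r,v_i)$ there are directed edges $\bar e_k^i$ from $(e_k,v_r)$ to $(e_k,v_i)$, with current $j_k^i$, and $\bar e_k^r$ from $(e_k,v_i)$ to $(e_k,v_r)$, with current $j_k^r$; for distinct edges $e_k,e_l$ with a common vertex $v_i$ there is a transition edge $\bar e_{kl}^i$ from $(e_k,v_i)$ to $(e_l,v_i)$. The directed edges pointing into an entrance vertex or out of an exit vertex are deleted (their currents are zero). The cost on $\bar e_k^i$ is $c_k^i(j_k^i-j_k^r)$, on $\bar e_k^r$ it is $c_k^r(j_k^r-j_k^i)$, and on $\bar e_{kl}^i$ it is $\psi_{kl}^i$; $\bar{\boldsymbol c}$ is the vector of these costs. $\mathcal A$ is the set of $\bar{\boldsymbol\jmath}\ge0$ satisfying Kirchhoff's law: at every non-exit vertex of $\bar\Gamma$, (sum of outgoing currents) $-$ (sum of incoming currents) equals the prescribed entry current at entrance vertices and $0$ at the others. A Wardrop equilibrium is $\bar{\boldsymbol\jmath}^*\in\mathcal A$ with $\langle\bar{\boldsymbol c}(\bar{\boldsymbol\jmath}^* ),\bar{\boldsymbol\jmath}^*-\bar{\boldsymbol\jmath}\rangle\le0$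 for all $\bar{\boldsymbol\jmath}\in\mathcal A$.
   Formalization: ''Increasing for positive current'' is taken as strictly increasing on j ≥ 0, zero included; with costs that jump down just after zero current (or are constant) uniqueness fails, e.g. on two parallel edges. Costs continuous at 0 are unaffected. *)

(* Defs.v *)
From HB Require Import structures.
From mathcomp Require Import all_boot all_order all_algebra.
From mathcomp Require Import all_classical all_reals all_analysis.

Set Implicit Arguments.
Unset Strict Implicit.
Unset Printing Implicit Defensive.

Import Order.TTheory GRing.Theory Num.Theory.
Import numFieldNormedType.Exports.

Local Open Scope classical_set_scope.
Local Open Scope ring_scope.

(** * Undirected networks *)

(* The edge k is identified with [0, 1] so that [endpoint k false] sits at 0
   and [endpoint k true] at 1; writing k = (v_r, v_i), these are v_r and v_i.
   Parallel edges are allowed, loops are not. *)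
Record network := Network {
  vertex : finType;
  edge : finType;
  endpoint : edge -> bool -> vertex;
  endpoint_neq : forall k, endpoint k false != endpoint k true;
  entrance : {set vertex};
  exit : {set vertex};
  entrance_exit_disjoint : forall v, v \in entrance -> v \notin exit;
  terminal_incidence : forall v, (v \in entrance) || (v \in exit) ->
    #|[pred k | [exists d, endpoint k d == v]]| = 1%N
}.

Definition incident (G : network) (k : edge G) (v : vertex G) : bool :=
  [exists d, endpoint k d == v].

Lemma incident_endpoint (G : network) (k : edge G) (d : bool) :
  incident k (endpoint k d).
Proof. by apply/existsP; exists d. Qed.

(** * Travel costs of a mean-field game on one edge *)

Section EdgeMFG.
Variable R : realType.
Implicit Type H : R -> R -> R -> R.

Definition smooth_convex_hamiltonian H : Prop :=
  forall x m : R, 0 <= x <= 1 -> 0 <= m ->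
    (forall n p, derivable (derive1n n (fun q : R => H x q m)) p 1) /\
    convex_function (setT : set R^o) (fun p : R^o => H x p m).

(* [m x j] is the density at x when the signed current is j; the function u is
   the value function of the stationary mean-field game on the edge. *)
Definition is_density H (m : R -> R -> R) : Prop :=
  forall j : R, exists u : R -> R, forall x : R, 0 <= x <= 1 ->
    [/\ derivable u x 1, 0 <= m x j, H x (derive1 u x) (m x j) = 0 &
        - m x j * derive1 (fun p : R => H x p (m x j)) (derive1 u x) = j].

Definition lagrangian H (x v m : R) : \bar R :=
  ereal_sup [set (- (p * v) - H x p m)%:E | p in [set: R]].

Definition trajectory (a b T : R) (x : R -> R) : Prop :=
  [/\ [lipschitz x t | t in `[0, T]],
      forall t, 0 <= t <= T -> 0 <= x t <= 1, x 0 = a & x T = b].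

(* A Lipschitz trajectory has a derivative almost everywhere on [0, T]; the
   junk value of [derive1 x] on the remaining null set does not affect the
   integral. *)
Definition action H (m : R -> R -> R) (j T : R) (x : R -> R) : \bar R :=
  (\int[lebesgue_measure]_(t in `[0%R, T])
     lagrangian H (x t) (derive1 x t) (m (x t) j))%E.

Definition actions H (m : R -> R -> R) (j a b : R) : set (\bar R) :=
  [set w | exists T x, [/\ 0 <= T, trajectory a b T x & w = action H m j T x]].

Definition is_travel_cost H (m : R -> R -> R) (a b : R) (c : R -> R) : Prop :=
  forall j, actions H m j a b (c j)%:E /\ lbound (actions H m j a b) (c j)%:E.

End EdgeMFG.

(** * Mean-field games on networks *)

(* [travel_cost k d j] is the cost of moving along k towards [endpoint k d]
   when the signed current in k is j: for k = (v_r, v_i), c_k^i is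
   [travel_cost k true] and c_k^r is [travel_cost k false]. *)
Record mfg (R : realType) := Mfg {
  graph :> network;
  entry_current : vertex graph -> R;
  entry_current_gt0 : forall v, v \in entrance graph -> 0 < entry_current v;
  hamiltonian : edge graph -> R -> R -> R -> R;
  hamiltonianP : forall k, smooth_convex_hamiltonian (hamiltonian k);
  density : edge graph -> R -> R -> R;
  densityP : forall k, is_density (hamiltonian k) (density k);
  travel_cost : edge graph -> bool -> R -> R;
  travel_costP : forall k (d : bool),
    is_travel_cost (hamiltonian k) (density k) (~~ d)%:R d%:R (travel_cost k d);
  (* [switch_cost k l v] is psi_kl^v, relevant only when k <> l meet at v *)
  switch_cost : edge graph -> edge graph -> vertex graph -> R;
  switch_cost_triangle : forall v k l p,
    incident k v -> incident l v -> incident p v ->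
    uniq [:: k; l; p] ->
    switch_cost k l v <= switch_cost k p v + switch_cost p l v
}.

(** * The corresponding Wardrop model *)

Section Wardrop.
Variables (R : realType) (M : mfg R).

Definition node : finType := {kv : edge M * vertex M | incident kv.1 kv.2}.

Definition end_node (k : edge M) (d : bool) : node :=
  exist _ (k, endpoint k d) (incident_endpoint k d).

Definition transition : finType :=
  {klv : edge M * edge M * vertex M |
    [&& klv.1.1 != klv.1.2, incident klv.1.1 klv.2 & incident klv.1.2 klv.2]}.

Lemma transition_source_subproof (t : transition) :
  incident (val t).1.1 (val t).2.
Proof. by case/and3P: (valP t). Qed.

Lemma transition_target_subproof (t : transition) :
  incident (val t).1.2 (val t).2.
Proof. by case/and3P: (valP t). Qed.

(* [inl (k, d)] is the directed edge along k towards [endpoint k d]. *)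
Definition directed_edge : finType := ((edge M * bool) + transition)%type.

Definition source (a : directed_edge) : node :=
  match a with
  | inl (k, d) => end_node k (~~ d)
  | inr t => exist _ ((val t).1.1, (val t).2) (transition_source_subproof t)
  end.

Definition target (a : directed_edge) : node :=
  match a with
  | inl (k, d) => end_node k d
  | inr t => exist _ ((val t).1.2, (val t).2) (transition_target_subproof t)
  end.

(* Deleted directed edges are kept in the index type [directed_edge] but carry
   zero current, see [feasible]. *)
Definition deleted (a : directed_edge) : bool :=
  ((val (target a)).2 \in entrance M) || ((val (source a)).2 \in exit M).

Definition travel_current (j : directed_edge -> R) (k : edge M) (d : bool) : R :=
  j (inl (k, d)).

Definition directed_edge_cost (j : directed_edge -> R) (a : directed_edge) : R :=
  match a with
  | inl (k, d) =>
      travel_cost k d (travel_current j k d - travel_current j k (~~ d))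
  | inr t => switch_cost (val t).1.1 (val t).1.2 (val t).2
  end.

Definition node_entry (n : node) : R :=
  if (val n).2 \in entrance M then entry_current (val n).2 else 0.

Definition kirchhoff (j : directed_edge -> R) : Prop :=
  forall n : node, (val n).2 \notin exit M ->
    \sum_(a | source a == n) j a - \sum_(a | target a == n) j a = node_entry n.

Definition feasible (j : directed_edge -> R) : Prop :=
  [/\ forall a, 0 <= j a, forall a, deleted a -> j a = 0 & kirchhoff j].

Definition wardrop_equilibrium (j : directed_edge -> R) : Prop :=
  feasible j /\
  forall j', feasible j' -> \sum_a directed_edge_cost j a * (j a - j' a) <= 0.

End Wardrop.

(** * Conditions on the travel costs *)

Section CostConditions.
Variables (R : realType) (M : mfg R) (k : edge M).

Definition reversible_cost : Prop :=
  forall j, travel_cost k true j = travel_cost k false j.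

Definition even_cost : Prop :=
  forall d j, travel_cost k d (- j) = travel_cost k d j.

(* Strict monotonicity on the closed half-line: on the open one alone a cost
   jumping down just after 0 would be allowed, and uniqueness would fail. *)
Definition increasing_cost : Prop :=
  forall d j1 j2, 0 <= j1 -> j1 < j2 -> travel_cost k d j1 < travel_cost k d j2.

(* Sum of the costs of the two directed edges along k. *)
Definition positive_round_trip_cost : Prop :=
  forall j : directed_edge M -> R,
    0 < directed_edge_cost j (inl (k, true)) + directed_edge_cost j (inl (k, false)).

End CostConditions.

(* Main.v *)
Require Import Defs.
From mathcomp Require Import all_boot all_order all_algebra.
From mathcomp Require Import all_classical all_reals all_analysis.
From mathcomp Require Import ring lra.

(** Cancelling opposite currents on an edge keeps a flow feasible and lowers its
    cost, so at an equilibrium at most one direction of each edge carries current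
    and the total current there is the absolute value of the signed one.
    Monotonicity of the costs then forces the absolute values of two equilibria
    to agree, hence both have the same cost vector and minimize the same linear
    functional.  So does their midpoint, which therefore carries no opposite
    currents either: the two equilibria have the same direction on each edge. *)

Set Implicit Arguments.
Unset Strict Implicit.
Unset Printing Implicit Defensive.

Import Order.TTheory GRing.Theory Num.Theory.

Local Open Scope ring_scope.

Lemma sum_pair_bool (R : nmodType) (I : finType) (F : I * bool -> R) :
  \sum_p F p = \sum_i (F (i, true) + F (i, false)).
Proof.
under [RHS]eq_bigr do rewrite -(big_bool _ (fun d => F (_, d))).
by rewrite pair_bigA; apply: eq_bigr => -[].
Qed.

Section Flows.
Variables (R : realType) (M : mfg R).
Implicit Types (j C : directed_edge M -> R) (k : edge M).

(** The cost vector [C] is frozen, so the functional is linear in the flow and the same [C] can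
    serve several flows. *)
Definition minimizes_cost C j : Prop :=
  feasible j /\ forall j', feasible j' -> \sum_a C a * j a <= \sum_a C a * j' a.

Definition along k (a : directed_edge M) : bool :=
  if a is inl (l, _) then l == k else false.

Definition cancel_current j k (e : R) (a : directed_edge M) : R :=
  j a - e *+ along k a.

Lemma sum_directed_edge (P : pred (directed_edge M)) (F : directed_edge M -> R) :
  \sum_(a | P a) F a =
  \sum_(kd : edge M * bool | P (inl kd)) F (inl kd) +
  \sum_(t : transition M | P (inr t)) F (inr t).
Proof. by rewrite big_sumType. Qed.

Lemma sum_along k (F : directed_edge M -> R) :
  \sum_a F a *+ along k a = F (inl (k, true)) + F (inl (k, false)).
Proof.
rewrite sum_directed_edge /= [X in _ + X]big1 ?addr0 //.
rewrite sum_pair_bool (bigD1 k) //= big1 ?addr0 ?eqxx // => l /negPf lk.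
by rewrite lk addr0.
Qed.

(** Flipping the direction swaps source and target along [k], so equal currents both ways form a
    circulation. *)
Lemma along_balanced k (n : node M) (e : R) :
  \sum_(a | source a == n) e *+ along k a = \sum_(a | target a == n) e *+ along k a.
Proof.
rewrite !sum_directed_edge /=; congr (_ + _); last by rewrite !big1.
rewrite (reindex_inj (h := fun kd : edge M * bool => (kd.1, ~~ kd.2))) /=.
  by apply: eq_big => -[l d] //=; rewrite negbK.
by move=> [l d] [l' d'] /= [-> /negb_inj ->].
Qed.

Lemma cancel_current_feasible j k (e : R) :
  0 <= e -> (forall d, e <= j (inl (k, d))) -> feasible j ->
  feasible (cancel_current j k e).
Proof.
move=> e0 le_e [j0 jdel jK]; split.
- move=> [[l d]|t]; rewrite /cancel_current /= ?subr0 //.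
  case: eqP => [->|_]; last by rewrite subr0.
  by rewrite subr_ge0.
- move=> [[l d]|t] /jdel ja0; rewrite /cancel_current /= ja0 ?subr0 //.
  case: eqP ja0 => [->|_] ja0; last by rewrite subr0.
  (* A deleted direction carries no current, which forces [e = 0]: nothing is subtracted there. *)
  have := le_e d; rewrite ja0 => e_le0.
  by rewrite sub0r (@le_anti _ _ e 0) ?oppr0 // e_le0 e0.
- move=> n nex; rewrite !big_split /= !sumrN (along_balanced k n e).
  by rewrite opprB addrA subrK jK.
Qed.

(** Cancelling the smaller of the two currents saves that amount times the round-trip cost, so
    minimality makes it zero. As [C] need not be the cost vector of [j], this also applies to
    midpoints. *)
Lemma no_opposite_currents C j k :
  minimizes_cost C j -> 0 < C (inl (k, true)) + C (inl (k, false)) ->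
  j (inl (k, true)) = 0 \/ j (inl (k, false)) = 0.
Proof.
move=> [fj minj] C0; have [j0 _ _] := fj.
set e := Order.min (j (inl (k, true))) (j (inl (k, false))).
have e0 : 0 <= e by rewrite le_min !j0.
have le_e d : e <= j (inl (k, d)) by case: d; rewrite ge_min lexx ?orbT.
have := minj _ (cancel_current_feasible e0 le_e fj).
have -> : \sum_a C a * cancel_current j k e a =
    \sum_a C a * j a - e * (C (inl (k, true)) + C (inl (k, false))).
  rewrite -sum_along mulr_sumr -sumrB; apply: eq_bigr => a _.
  by rewrite mulrBr mulrnAr mulrnAr (mulrC e).
rewrite lerBrDl gerDr pmulr_lle0 // => e_le0.
have : e = 0 by apply/le_anti/andP.
rewrite /e; case: leP => _ ->; by [left|right].
Qed.

Lemma feasible_midpoint j j' :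
  feasible j -> feasible j' -> feasible (fun a => (j a + j' a) / 2).
Proof.
move=> [j0 jdel jK] [j'0 j'del j'K]; split.
- by move=> a; rewrite divr_ge0 ?addr_ge0.
- by move=> a ad; rewrite jdel // j'del // addr0 mul0r.
- move=> n nex; rewrite -!mulr_suml !big_split /=.
  have := jK n nex; have := j'K n nex; lra.
Qed.

Lemma minimizes_cost_midpoint C j j' :
  minimizes_cost C j -> minimizes_cost C j' ->
  minimizes_cost C (fun a => (j a + j' a) / 2).
Proof.
move=> [fj minj] [fj' minj']; split=> [|i fi]; first exact: feasible_midpoint.
have -> : \sum_a C a * ((j a + j' a) / 2) =
    (\sum_a C a * j a + \sum_a C a * j' a) / 2.
  by rewrite -big_split mulr_suml; apply: eq_bigr => a _; rewrite mulrA mulrDr.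
have := minj _ fi; have := minj' _ fi; lra.
Qed.

(** With the costs frozen at [j], the variational inequality is linear minimality. *)
Lemma wardrop_minimizes_cost j :
  wardrop_equilibrium j -> minimizes_cost (directed_edge_cost j) j.
Proof.
move=> [fj eqj]; split=> // j' /eqj.
under eq_bigr do rewrite mulrBr.
by rewrite sumrB subr_le0.
Qed.

Lemma directed_edge_cost_abs j k d :
  reversible_cost k -> even_cost k ->
  directed_edge_cost j (inl (k, d)) =
  travel_cost k true `|j (inl (k, true)) - j (inl (k, false))|.
Proof.
move=> rev even.
have abs x : travel_cost k true `|x| = travel_cost k true x.
  by case: (ger0P x).
by case: d; rewrite abs //= -rev -even opprB.
Qed.

Lemma total_current_equilibrium j k :
  wardrop_equilibrium j -> positive_round_trip_cost k ->
  j (inl (k, true)) + j (inl (k, false)) =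
  `|j (inl (k, true)) - j (inl (k, false))|.
Proof.
move=> eqj pos; have [[j0 _ _] _] := eqj.
have [-> | ->] := no_opposite_currents (wardrop_minimizes_cost eqj) (pos j).
  by rewrite add0r sub0r normrN ger0_norm.
by rewrite addr0 subr0 ger0_norm.
Qed.

(* The equality case below is what later turns vanishing terms into equal currents. *)
End Flows.

Lemma increasing_mul_ge0 (R : realDomainType) (c : R -> R) (x y : R) :
  (forall u v, 0 <= u -> u < v -> c u < c v) -> 0 <= x -> 0 <= y ->
  0 <= (c x - c y) * (x - y) ?= iff (x == y).
Proof.
move=> inc x0 y0; split; rewrite ?[0 == _]eq_sym ?mulf_eq0 ?subr_eq0;
  case: (ltgtP x y) => [xy|yx|->]; rewrite ?subrr ?mulr0 ?eqxx ?orbT ?orbF //.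
- by rewrite ltW // nmulr_rgt0 subr_lt0 // inc.
- by rewrite ltW // pmulr_rgt0 subr_gt0 // inc.
- by rewrite lt_eqF // inc.
- by rewrite gt_eqF // inc.
Qed.

Section Equilibria.
Variables (R : realType) (M : mfg R).
Hypotheses (Hrev : forall k : edge M, reversible_cost k)
  (Heven : forall k : edge M, even_cost k)
  (Hincr : forall k : edge M, increasing_cost k)
  (Hpos : forall k : edge M, positive_round_trip_cost k).
Variables j1 j2 : directed_edge M -> R.
Hypotheses (Hj1 : wardrop_equilibrium j1) (Hj2 : wardrop_equilibrium j2).

(** Testing each equilibrium against the other and adding the two inequalities bounds by zero a sum
    of nonnegative monotonicity terms, one per edge; hence each term vanishes. *)
Lemma equilibria_total_current (k : edge M) :
  j1 (inl (k, true)) + j1 (inl (k, false)) =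
  j2 (inl (k, true)) + j2 (inl (k, false)).
Proof.
pose s (j : directed_edge M -> R) l := j (inl (l, true)) + j (inl (l, false)).
pose c (l : edge M) : R -> R := travel_cost l true.
have s0 j l : wardrop_equilibrium j -> 0 <= s j l.
  by move=> [[j0 _ _] _]; rewrite addr_ge0.
have costE j l d : wardrop_equilibrium j ->
    directed_edge_cost j (inl (l, d)) = c l (s j l).
  move=> eqj; rewrite directed_edge_cost_abs //.
  by rewrite -(total_current_equilibrium eqj).
have term l := increasing_mul_ge0 (@Hincr l true) (s0 _ l Hj1) (s0 _ l Hj2).
have : \sum_l (c l (s j1 l) - c l (s j2 l)) * (s j1 l - s j2 l) <= 0.
  have -> : \sum_l (c l (s j1 l) - c l (s j2 l)) * (s j1 l - s j2 l) =
      \sum_a directed_edge_cost j1 a * (j1 a - j2 a) +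
      \sum_a directed_edge_cost j2 a * (j2 a - j1 a).
    (* Transition costs are the same for both flows and cancel. Both directions of [l] share one
       cost, so only the total currents remain. *)
    rewrite -big_split /= sum_directed_edge [X in _ = _ + X]big1 => [|t _].
      rewrite addr0 sum_pair_bool; apply: eq_bigr => l _.
      rewrite !costE // /s; ring.
    by rewrite /= -mulrDr addrC subrKA subrr mulr0.
  have [[f1 opt1] [f2 opt2]] := (Hj1, Hj2).
  by rewrite -oppr_ge0 opprD addr_ge0 // oppr_ge0 ?opt1 ?opt2.
move=> sum_le0.
have /eqP : \sum_l (c l (s j1 l) - c l (s j2 l)) * (s j1 l - s j2 l) = 0.
  apply/le_anti; rewrite sum_le0 /= sumr_ge0 // => l _.
  by case: (term l).
rewrite psumr_eq0 => [/allP /(_ k (mem_index_enum _))|l _]; last by case: (term l).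
by have [_] := term k; rewrite eq_sym => -> /eqP.
Qed.

Lemma equilibria_cost : directed_edge_cost j1 = directed_edge_cost j2.
Proof.
apply/funext => -[[k d]|t] //.
rewrite !directed_edge_cost_abs // -(total_current_equilibrium Hj1) //.
by rewrite -(total_current_equilibrium Hj2) // equilibria_total_current.
Qed.

End Equilibria.

Theorem proposition5p4 (R : realType) (M : mfg R)
  (Hrev : forall k : edge M, reversible_cost k)
  (Heven : forall k : edge M, even_cost k)
  (Hincr : forall k : edge M, increasing_cost k)
  (Hpos : forall k : edge M, positive_round_trip_cost k)
  (j1 j2 : directed_edge M -> R)
  (Hj1 : wardrop_equilibrium j1) (Hj2 : wardrop_equilibrium j2)
  (k : edge M) (d : bool) :
  travel_current j1 k d = travel_current j2 k d.
Proof.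
rewrite /travel_current.
have min1 := wardrop_minimizes_cost Hj1.
have min2 := wardrop_minimizes_cost Hj2.
(* Both flows now minimize the functional with the costs of [j1]. *)
rewrite -(equilibria_cost Hrev Heven Hincr Hpos Hj1 Hj2) in min2.
have total := equilibria_total_current Hrev Heven Hincr Hpos Hj1 Hj2 k.
have [[j1_ge0 _ _] _] := min1; have [[j2_ge0 _ _] _] := min2.
(* The midpoint vanishes in one direction, so both nonnegative currents vanish there; equal totals
   settle the other direction. *)
have [/= m0|/= m0] :=
  no_opposite_currents (minimizes_cost_midpoint min1 min2) (Hpos k j1).
  have := j1_ge0 (inl (k, true)); have := j2_ge0 (inl (k, true)).
  by case: d; lra.
have := j1_ge0 (inl (k, false)); have := j2_ge0 (inl (k, false)).
by case: d; lra.
Qed.
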